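(* Let $\mathcal G$ be a finitely generated group, $S\subseteq\mathcal G$ a finite generating set containing the identity, and $X$ an $S$-Markov shift over an alphabet $\{1,\dots,k\}$. Then the groupoid $\Gamma_X$ is homotopically uniquely generated by $H_X$.
   Context: $S$ need not be symmetric. For a finite alphabet $K$, $K^{\mathcal G}$ has the product topology and the action $\sigma_g(x)_h=x_{g^{-1}h}$. For $\mathcal R\subseteq K^S$, the $S$-Markov shift is $X_{\mathcal R}=\{x:\sigma_g(x)|_S\in\mathcal R\ \forall g\in\mathcal G\}$. A $\mathcal G$-equivariant map $\varphi:X\to Y$ between $S$-Markov shifts over alphabets $K,L$ has neighborhood $T\subseteq\mathcal G$ if $\varphi(x)_g=\varphi_{\mathrm{loc}}(\sigma_{g^{-1}}(x)|_T)$ for some $\varphi_{\mathrm{loc}}:K^T\to L$. $\Gamma$ is the groupoid whose objects are $S$-Markov shifts over alphabets $\{1,\dots,k\}$ ($k\in\mathbb N$) and whose morphisms are $\mathcal G$-equivariant homeomorphisms; $H\subseteq\Gamma^1$ consists of those with neighborhood $S$ whose inverse has neighborhood $S^{-1}$; $\Gamma_X$ is the connected component of $X$ and $H_X=H\cap\Gamma_X^1$. For a groupoid $\Gamma'$ (composition written right to left) and $H'\subseteq\Gamma'^1$: $H'$ generates $\Gamma'$ if it contains all identities and every morphism is a composite of elements of $H'\cup H'^{-1}$. The nerve $\mathcal N(\Gamma',H')$ is the $\Delta$-complex whose $n$-simplices are tuples of objects $(X_0,\dots,X_n)$ with morphisms $\varphi_{i,j}:X_i\to X_j$ in $H'$ ($i<j$)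 such that $\varphi_{j,k}\circ\varphi_{i,j}=\varphi_{i,k}$ for $i<j<k$; a composable sequence in $H'\cup H'^{-1}$ is an edge path in it (edges traversed forward or backward). $H'$ homotopically uniquely generates $\Gamma'$ if $H'$ generates $\Gamma'$ and any two composable sequences in $H'\cup H'^{-1}$ with the same composite are homotopic (rel endpoints) as paths in $\mathcal N(\Gamma',H')$. *)

(* Defs.v *)
From Stdlib Require Import List Relation_Operators.
Import ListNotations.

Record Group := {
  gcar :> Type;
  gmul : gcar -> gcar -> gcar;
  ginv : gcar -> gcar;
  gone : gcar;
  gmulA : forall a b c, gmul a (gmul b c) = gmul (gmul a b) c;
  gmul1l : forall a, gmul gone a = a;
  gmulVl : forall a, gmul (ginv a) a = gone
}.

Section Shifts.
Variable G : Group.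

Definition finite_subset (S : G -> Prop) : Prop :=
  exists l : list G, forall s, S s <-> In s l.

Definition generates (S : G -> Prop) : Prop :=
  forall g : G, exists l : list G,
    Forall (fun s => S s \/ S (ginv G s)) l /\ g = fold_right (gmul G) (gone G) l.

Definition set_inv (S : G -> Prop) : G -> Prop := fun g => S (ginv G g).

(* Configurations x : G -> nat ; alphabet {1,...,k} means values in [1,k].
   Shift action: (sigma_g x)_h = x_{g^-1 h}. *)
Definition config := G -> nat.
Definition shift (g : G) (x : config) : config := fun h => x (gmul G (ginv G g) h).

Definition restr (T : G -> Prop) (x : config) : {t : G | T t} -> nat :=
  fun t => x (proj1_sig t).

Record Ob := { ob_k : nat; ob_set : config -> Prop }.

Definition is_markov (S : G -> Prop) (A : Ob) : Prop :=
  exists R : ({s : G | S s} -> nat) -> Prop,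
    forall x : config, ob_set A x <->
      ((forall h, 1 <= x h <= ob_k A) /\ forall g, R (restr S (shift g x))).

(* continuity (product topology of discrete finite alphabets, subspace
   topology on A), written out via cylinder neighbourhoods *)
Definition continuous_on (A : Ob) (f : config -> config) : Prop :=
  forall x, ob_set A x -> forall h : G, exists F : list G,
    forall x', ob_set A x' -> (forall t, In t F -> x' t = x t) -> f x' h = f x h.

Definition equivariant_on (A : Ob) (f : config -> config) : Prop :=
  forall x, ob_set A x -> forall g : G, f (shift g x) = shift g (f x).

Definition iso_pair (A B : Ob) (f g : config -> config) : Prop :=
  (forall x, ob_set A x -> ob_set B (f x)) /\
  (forall y, ob_set B y -> ob_set A (g y)) /\
  (forall x, ob_set A x -> g (f x) = x) /\
  (forall y, ob_set B y -> f (g y) = y) /\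
  continuous_on A f /\ continuous_on B g /\ equivariant_on A f.

(* morphisms of Gamma from A to B (identified when equal on A) *)
Definition gamma_mor (A B : Ob) (f : config -> config) : Prop :=
  exists g, iso_pair A B f g.

Definition has_nbhd (T : G -> Prop) (A : Ob) (f : config -> config) : Prop :=
  exists loc : ({t : G | T t} -> nat) -> nat,
    forall x, ob_set A x -> forall g : G, f x g = loc (restr T (shift (ginv G g) x)).

Record Edge := { e_src : Ob; e_tgt : Ob; e_fwd : config -> config; e_bwd : config -> config }.

Definition in_H (S : G -> Prop) (e : Edge) : Prop :=
  is_markov S (e_src e) /\ is_markov S (e_tgt e) /\
  iso_pair (e_src e) (e_tgt e) (e_fwd e) (e_bwd e) /\
  has_nbhd S (e_src e) (e_fwd e) /\ has_nbhd (set_inv S) (e_tgt e) (e_bwd e).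

Definition id_edge (A : Ob) : Edge :=
  {| e_src := A; e_tgt := A; e_fwd := fun x => x; e_bwd := fun x => x |}.

(* composable sequences in H u H^-1: true = forward, false = inverse *)
Definition epath := list (bool * Edge).

Fixpoint valid (S : G -> Prop) (A : Ob) (p : epath) (B : Ob) : Prop :=
  match p with
  | [] => A = B
  | (true, e) :: p' => in_H S e /\ e_src e = A /\ valid S (e_tgt e) p' B
  | (false, e) :: p' => in_H S e /\ e_tgt e = A /\ valid S (e_src e) p' B
  end.

Fixpoint composite (p : epath) (x : config) : config :=
  match p with
  | [] => x
  | (true, e) :: p' => composite p' (e_fwd e x)
  | (false, e) :: p' => composite p' (e_bwd e x)
  end.

(* two edge records represent the same 1-simplex of the nerve *)
Definition same_edge (e e' : Edge) : Prop :=
  e_src e = e_src e' /\ e_tgt e = e_tgt e' /\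
  forall x, ob_set (e_src e) x -> e_fwd e x = e_fwd e' x.

(* 2-simplex (X0,X1,X2) with phi01 = e01, phi12 = e12, phi02 = e02 *)
Definition triangle (S : G -> Prop) (e01 e12 e02 : Edge) : Prop :=
  in_H S e01 /\ in_H S e12 /\ in_H S e02 /\
  e_tgt e01 = e_src e12 /\ e_src e02 = e_src e01 /\ e_tgt e02 = e_tgt e12 /\
  forall x, ob_set (e_src e01) x -> e_fwd e12 (e_fwd e01 x) = e_fwd e02 x.

(* elementary homotopies of edge paths in the nerve (Delta-complex) *)
Inductive elem (S : G -> Prop) : epath -> epath -> Prop :=
  | elem_back_fb e : elem S [(true, e); (false, e)] []
  | elem_back_bf e : elem S [(false, e); (true, e)] []
  | elem_tri e01 e12 e02 : triangle S e01 e12 e02 ->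
      elem S [(true, e01); (true, e12)] [(true, e02)]
  | elem_same b e e' : same_edge e e' -> elem S [(b, e)] [(b, e')].

Definition htpy_step (S : G -> Prop) (A B : Ob) (p q : epath) : Prop :=
  exists p1 m m' p2, p = p1 ++ m ++ p2 /\ q = p1 ++ m' ++ p2 /\ elem S m m' /\
    valid S A p B /\ valid S A q B.

Definition homotopic (S : G -> Prop) (A B : Ob) (p q : epath) : Prop :=
  valid S A p B /\ valid S A q B /\ clos_refl_sym_trans epath (htpy_step S A B) p q.

Definition in_comp (S : G -> Prop) (X Y : Ob) : Prop :=
  is_markov S Y /\ exists f, gamma_mor X Y f.

Definition homotopically_uniquely_generates (S : G -> Prop) (X : Ob) : Prop :=
  (forall Y, in_comp S X Y -> in_H S (id_edge Y)) /\
  (forall Y Z f, in_comp S X Y -> in_comp S X Z -> gamma_mor Y Z f ->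
     exists p, valid S Y p Z /\ forall x, ob_set Y x -> composite p x = f x) /\
  (forall Y Z p q, in_comp S X Y -> in_comp S X Z ->
     valid S Y p Z -> valid S Y q Z ->
     (forall x, ob_set Y x -> composite p x = composite q x) ->
     homotopic S Y Z p q).

End Shifts.

(* Main.v *)
(** Fix a shift [Y] and describe an object of its component, together with a
    homeomorphism from [Y], by a finite-valued code [v] on [Y]; order codes by refinement,
    and let [v^S] be the block code of [v] over [S].  There is an edge [v -> w] of the
    nerve iff [w <= v^S] and [v <= w^(S^-1)].  Each [v] is joined to a far vertex [p^W] by a
    cone path: first pass from [v] to [v^S] or [v^(S^-1)] until the result refines [p], then
    repeatedly join with [p^S] or [p^(S^-1)] until [p^W] is reached.  All these codes are
    again S-Markov.  After factoring an edge [v -> w] through the join of [v] and [w],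
    each step of the cone moves the edge across finitely many triangles, so every edge is
    homotopic to the cone path of its source followed by the reversed cone path of its
    target.  Hence a path is determined up to homotopy by its two marked endpoints, that
    is, by its composite. *)

From Stdlib Require Import List Lia Arith Relation_Operators.
From Stdlib Require Import ClassicalEpsilon FunctionalExtensionality PropExtensionality ProofIrrelevance.
Require Import Defs.
Import ListNotations.

Create HintDb codes.

(** * Group laws from the left-handed axioms *)

Section GroupLaws.
Variable G : Group.
Arguments gmul {_}.
Arguments ginv {_}.
Arguments gone {_}.

Lemma gmulVr (a : G) : gmul a (ginv a) = gone.
Proof.
  rewrite <- (gmul1l G (gmul a (ginv a))).
  rewrite <- (gmulVl G (ginv a)) at 1.
  rewrite <- (gmulA G), (gmulA G (ginv a)), gmulVl, gmul1l.
  apply gmulVl.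
Qed.

Lemma gmul1r (a : G) : gmul a gone = a.
Proof. now rewrite <- (gmulVl G a), gmulA, gmulVr, gmul1l. Qed.

Lemma ginv_unique (a b : G) : gmul a b = gone -> ginv a = b.
Proof.
  intros H. now rewrite <- (gmul1r (ginv a)), <- H, gmulA, gmulVl, gmul1l.
Qed.

Lemma ginvK (a : G) : ginv (ginv a) = a.
Proof. apply ginv_unique, gmulVl. Qed.

Lemma ginv1 : ginv gone = gone :> G.
Proof. apply ginv_unique, gmul1l. Qed.

Lemma ginv_mul (a b : G) : ginv (gmul a b) = gmul (ginv b) (ginv a).
Proof.
  apply ginv_unique.
  now rewrite <- gmulA, (gmulA G b), gmulVr, gmul1l, gmulVr.
Qed.

End GroupLaws.

(** * Shifts of configurations, local rules and Markov shifts *)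

Section Configurations.
Variable G : Group.
Arguments gmul {_}.
Arguments ginv {_}.
Arguments gone {_}.
Arguments shift {_}.
Arguments ob_k {_}.
Arguments ob_set {_}.
Arguments iso_pair {_}.
Arguments is_markov {_}.
Arguments restr {_}.
Arguments has_nbhd {_}.

Lemma Ob_ext (A A' : Ob G) :
  ob_k A = ob_k A' -> (forall y, ob_set A y <-> ob_set A' y) -> A = A'.
Proof.
  destruct A as [k P], A' as [k' P']; simpl; intros -> H.
  f_equal. apply functional_extensionality; intros y.
  now apply propositional_extensionality.
Qed.

Lemma shift_mul (a b : G) x : shift (gmul a b) x = shift a (shift b x).
Proof.
  apply functional_extensionality; intros h; unfold shift.
  now rewrite ginv_mul, gmulA.
Qed.

Lemma shift_one (x : config G) : shift gone x = x.
Proof.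
  apply functional_extensionality; intros h; unfold shift.
  now rewrite ginv1, gmul1l.
Qed.

(** Trades the local rule for a determinacy condition. Letting the two positions [g] and [g'] vary
    independently makes a single rule serve the whole group. *)
Lemma has_nbhd_iff (T : G -> Prop) (A : Ob G) f :
  has_nbhd T A f <->
  forall x x' g g', ob_set A x -> ob_set A x' ->
    (forall t, T t -> x (gmul g t) = x' (gmul g' t)) -> f x g = f x' g'.
Proof.
  split.
  - intros [loc H] x x' g g' Ax Ax' E.
    rewrite !H by assumption. f_equal.
    apply functional_extensionality; intros [t Tt].
    unfold restr, shift; simpl. rewrite !ginvK. auto.
  - intros H.
    pose (spec := fun (u : {t : G | T t} -> nat) n => exists x g, ob_set A x /\
             u = restr T (shift (ginv g) x) /\ n = f x g).
    (* The rule sends a pattern to some value occurring with it, and is arbitrary on patterns that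
       never occur. *)
    exists (fun u => epsilon (inhabits 0) (spec u)).
    intros x Ax g.
    assert (Hs : spec (restr T (shift (ginv g) x)) (f x g))
      by (exists x, g; auto).
    pose proof (epsilon_spec (inhabits 0) (spec _) (ex_intro _ _ Hs))
      as (x' & g' & Ax' & Eu & ->).
    apply H; auto. intros t Tt.
    apply (f_equal (fun u => u (exist _ t Tt))) in Eu.
    unfold restr, shift in Eu; simpl in Eu. now rewrite !ginvK in Eu.
Qed.

Lemma markov_shift S (A : Ob G) : is_markov S A ->
  forall g x, ob_set A x -> ob_set A (shift g x).
Proof.
  intros [R HR] g x Ax. apply HR in Ax as [Hr Hx]. apply HR. split.
  - intros h. apply Hr.
  - intros h. rewrite <- shift_mul. apply Hx.
Qed.

Lemma markov_range S (A : Ob G) : is_markov S A ->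
  forall x, ob_set A x -> forall h, 1 <= x h <= ob_k A.
Proof. intros [R HR] x Ax. now apply HR in Ax. Qed.

(** Membership test that hides the set of allowed patterns: a window seen in a point of [A] is
    allowed, since that point satisfies the rule at the identity. *)
Lemma markov_local S (A : Ob G) : is_markov S A ->
  forall y, (forall h, 1 <= y h <= ob_k A) ->
  (forall g, exists x, ob_set A x /\ forall s, S s -> y (gmul g s) = x s) ->
  ob_set A y.
Proof.
  intros [R HR] y Hr Hy. apply HR. split; [exact Hr|]. intros g.
  destruct (Hy (ginv g)) as (x & Ax & E).
  apply HR in Ax as [_ Hx]. specialize (Hx gone). rewrite shift_one in Hx.
  replace (restr S (shift g y)) with (restr S x); [exact Hx|].
  apply functional_extensionality; intros [s Ss]. symmetry. now apply E.
Qed.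

(** Only the forward map is assumed equivariant; writing a point as [f (g y)] and using shift
    invariance of [A] transfers equivariance to the inverse. *)
Lemma iso_pair_sym S (A A' : Ob G) f g : is_markov S A ->
  iso_pair A A' f g -> iso_pair A' A g f.
Proof.
  intros MA (H1 & H2 & H3 & H4 & H5 & H6 & H7).
  repeat split; auto. intros y Ay h.
  rewrite <- (H4 y Ay) at 1.
  rewrite <- (H7 _ (H2 _ Ay)). apply H3. apply (markov_shift S); auto.
Qed.

End Configurations.

(** * Codes and Markov shifts *)

Section Codes.
Variable G : Group.
Arguments gmul {_}.
Arguments ginv {_}.
Arguments gone {_}.
Arguments shift {_}.
Arguments ob_k {_}.
Arguments ob_set {_}.
Arguments iso_pair {_}.
Arguments is_markov {_}.
Arguments restr {_}.
Arguments has_nbhd {_}.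
Arguments e_src {_}.
Arguments e_tgt {_}.
Arguments e_fwd {_}.
Arguments e_bwd {_}.
Arguments in_H {_}.
Arguments valid {_}.
Arguments composite {_}.
Arguments same_edge {_}.
Arguments triangle {_}.
Arguments homotopic {_}.

Variables (S : G -> Prop) (SL : list G).
Hypothesis SL_spec : forall s, S s <-> In s SL.
Hypothesis S_one : S gone.

Variables (B : Type) (act : G -> B -> B).
Hypothesis act_mul : forall g h x, act (gmul g h) x = act g (act h x).
Hypothesis act_one : forall x, act gone x = x.

(** [B] stands for the points of the fixed shift. A code records the symbol at the identity of an
    equivariant image of a point. The size is kept because it becomes the alphabet of an object,
    which the partition alone does not determine. *)
Record code := {
  csize : nat;
  cval :> B -> nat;
  crange : forall x, 1 <= cval x <= csize
}.

Lemma code_ext (a b : code) : csize a = csize b -> (forall x, a x = b x) -> a = b.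
Proof.
  destruct a as [k f H], b as [k' f' H']; simpl; intros <- E.
  assert (f = f') as <- by now apply functional_extensionality.
  f_equal. apply proof_irrelevance.
Qed.

(** Mixed-radix numbering of pairs, with digits counted from 1; in the refinement order this is the
    supremum. *)
Program Definition join (a b : code) : code :=
  {| csize := csize a * csize b; cval := fun x => (a x - 1) * csize b + b x |}.
Next Obligation.
  pose proof (crange a x); pose proof (crange b x). nia.
Qed.

Lemma join_eq a b x x' : join a b x = join a b x' <-> a x = a x' /\ b x = b x'.
Proof.
  simpl. pose proof (crange a x); pose proof (crange b x).
  pose proof (crange a x'); pose proof (crange b x').
  split; [intros E | intros [-> ->]; reflexivity].
  assert (a x = a x') by nia. split; [assumption|]. nia.
Qed.

Program Definition pull (g : G) (a : code) : code :=
  {| csize := csize a; cval := fun x => a (act g x) |}.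
Next Obligation. apply crange. Qed.

Program Definition unit_code : code := {| csize := 1; cval := fun _ => 1 |}.

(* The coordinate at [g] of the configuration coded by [x] is [a (act (ginv g) x)],
   so [l = true] looks at the window [S] and [l = false] at [S^-1]. *)
Definition mv (l : bool) (s : G) : G := if l then ginv s else s.

(** The block code over [S] or [S^-1]. Its numbering depends on the enumeration [SL], its partition
    does not. *)
Definition pw (l : bool) (a : code) : code :=
  fold_right (fun s b => join (pull (mv l s) a) b) unit_code SL.

Lemma pw_eq l a x x' :
  pw l a x = pw l a x' <->
  forall s, S s -> a (act (mv l s) x) = a (act (mv l s) x').
Proof.
  assert (H : pw l a x = pw l a x' <->
    forall s, In s SL -> a (act (mv l s) x) = a (act (mv l s) x')).
  { unfold pw. clear SL_spec. induction SL as [|t L IH].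
    - simpl. split; [intros _ s [] | reflexivity].
    - change (fold_right ?f ?u (t :: L)) with (f t (fold_right f u L)).
      cbv beta. rewrite join_eq, IH. simpl.
      split; [intros [H1 H2] s [<-|Hs]; auto | intros H; split; auto]. }
  rewrite H. split; intros K s Hs; apply K; now apply SL_spec.
Qed.

Definition le (a b : code) : Prop := forall x x', b x = b x' -> a x = a x'.

(** The coded form of a local rule from [a] to [b] with neighborhood [S] or [S^-1]. *)
Definition dt (l : bool) (a b : code) : Prop := le b (pw l a).

Lemma dt_spec l a b : dt l a b <-> forall x x',
  (forall s, S s -> a (act (mv l s) x) = a (act (mv l s) x')) -> b x = b x'.
Proof.
  unfold dt, le. split; intros H x x' E; apply H; now apply pw_eq.
Qed.

Lemma le_refl a : le a a.
Proof. intros x x' E; exact E. Qed.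

Lemma le_trans b a c : le a b -> le b c -> le a c.
Proof. intros H1 H2 x x' E; auto. Qed.

Lemma le_join_l a b c : le a b -> le a (join b c).
Proof. intros H x x' E. apply join_eq in E. apply H, E. Qed.

Lemma le_join_r a b c : le a c -> le a (join b c).
Proof. intros H x x' E. apply join_eq in E. apply H, E. Qed.

Lemma join_le a b c : le a c -> le b c -> le (join a b) c.
Proof. intros H1 H2 x x' E. apply join_eq. auto. Qed.

(** The identity lies in both windows, so a block contains its central symbol. *)
Lemma le_pw_self l a : le a (pw l a).
Proof.
  intros x x' E. rewrite pw_eq in E. specialize (E gone S_one).
  destruct l; simpl in E; rewrite ?ginv1, !act_one in E; exact E.
Qed.

Lemma pw_mono l a b : le a b -> le (pw l a) (pw l b).
Proof.
  intros H x x' E. rewrite pw_eq in *. intros s Ss. apply H; auto.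
Qed.

Lemma le_pw l a b : dt l b a -> le a (pw l b).
Proof. exact id. Qed.

Lemma dt_le l a b : le b a -> dt l a b.
Proof. intros H. exact (le_trans _ _ _ H (le_pw_self l a)). Qed.

Lemma dt_join l a b c : dt l a b -> dt l a c -> dt l a (join b c).
Proof. apply join_le. Qed.

Lemma dt_trans_le l a b c : le a b -> dt l a c -> dt l b c.
Proof. intros H1 H2. exact (le_trans _ _ _ H2 (pw_mono l a b H1)). Qed.

Lemma dt_join_l l a b c : dt l a c -> dt l (join a b) c.
Proof. apply dt_trans_le, le_join_l, le_refl. Qed.

Lemma dt_join_r l a b c : dt l b c -> dt l (join a b) c.
Proof. apply dt_trans_le, le_join_r, le_refl. Qed.

Lemma dt_pw_l l l' a c : dt l a c -> dt l (pw l' a) c.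
Proof. apply dt_trans_le, le_pw_self. Qed.

Lemma dt_pw l a b : le b a -> dt l a (pw l b).
Proof. apply pw_mono. Qed.

#[local] Hint Resolve le_refl le_join_l le_join_r join_le pw_mono le_pw dt_le dt_join
  dt_join_l dt_join_r dt_pw_l dt_pw : codes.

(** The equivariant map into configurations with identity coordinate [a]; the inverse makes it
    intertwine [act] with [shift]. *)
Definition hat (a : code) (x : B) : config G := fun g => a (act (ginv g) x).

Lemma hat_one a x : hat a x gone = a x.
Proof. unfold hat. now rewrite ginv1, act_one. Qed.

Lemma hat_act a g x : hat a (act g x) = shift g (hat a x).
Proof.
  apply functional_extensionality; intros h; unfold hat, shift.
  now rewrite ginv_mul, ginvK, act_mul.
Qed.

Lemma hat_mul a g s x : hat a x (gmul g s) = hat a (act (ginv g) x) s.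
Proof. rewrite hat_act. unfold shift. now rewrite ginvK. Qed.

Definition Obj (a : code) : Ob G :=
  {| ob_k := csize a; ob_set := fun y => exists x, y = hat a x |}.

Lemma Obj_hat a x : ob_set (Obj a) (hat a x).
Proof. now exists x. Qed.

(** The Markov property of the image of [hat a], taking as allowed patterns exactly those that
    occur. The alphabet bound is implicit, as every coordinate lies in its own window. *)
Definition markov (a : code) : Prop :=
  forall y : config G,
    (forall g, exists x, forall s, S s -> y (gmul g s) = hat a x s) ->
    exists x, y = hat a x.

(** Faithfulness makes [hat a] a bijection from [B] onto [Obj a], so the code is an object together
    with a marking by [B]. *)
Definition faithful (a : code) : Prop :=
  forall x x', hat a x = hat a x' -> x = x'.

Definition good (a : code) : Prop := markov a /\ faithful a.

Lemma markov_Obj a : is_markov S (Obj a) <-> markov a.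
Proof.
  split.
  - intros M y Hy. apply (markov_local _ _ _ M).
    + intros h. destruct (Hy h) as [x E]. specialize (E _ S_one).
      rewrite gmul1r in E. rewrite E. apply crange.
    + intros g. destruct (Hy g) as [x E]. exists (hat a x). split; [apply Obj_hat | exact E].
  - intros M.
    exists (fun u => exists x, u = restr S (hat a x)). intros y. split.
    + intros [x ->]. split; [intros h; apply crange|].
      intros g. exists (act g x). now rewrite hat_act.
    + intros [_ H]. apply M. intros g. destruct (H (ginv g)) as [x E].
      exists x. intros s Ss. apply (f_equal (fun u => u (exist _ s Ss))) in E.
      unfold restr, shift in E; simpl in E. now rewrite ginvK in E.
Qed.

Lemma faithful_le a b : le a b -> faithful a -> faithful b.
Proof.
  intros H F x x' E. apply F. apply functional_extensionality; intros g.
  apply H. exact (f_equal (fun u => u g) E).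
Qed.

(* A locally admissible [m]-configuration [y] projects to a locally admissible
   [r]-configuration, which is coded by some [x]. *)
Lemma markov_lift r m y : markov r -> le r m ->
  (forall g, exists x, forall s, S s -> y (gmul g s) = hat m x s) ->
  exists x (X : G -> B),
    (forall g s, S s -> y (gmul g s) = hat m (X g) s) /\
    (forall g, r (X g) = hat r x g) /\
    (forall g s, S s -> hat r (X g) s = hat r x (gmul g s)).
Proof.
  intros Mr L Hy.
  pose (X := fun g => proj1_sig (constructive_indefinite_description _ (Hy g))).
  assert (HX : forall g s, S s -> y (gmul g s) = hat m (X g) s)
    by (intros g; exact (proj2_sig (constructive_indefinite_description _ (Hy g)))).
  (* The windows at [g] and at [g s] both show the entry of [y] at [g s]; the two points chosen
     there thus share an [m]-symbol, and a fortiori an [r]-symbol. *)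
  assert (K : forall g s, S s -> hat r (X g) s = r (X (gmul g s))).
  { intros g s Ss. rewrite <- (hat_one r). unfold hat at 1 2.
    rewrite ginv1, act_one. apply L.
    change (hat m (X g) s = m (X (gmul g s))).
    rewrite <- HX by assumption. rewrite <- (hat_one m), <- HX by assumption.
    now rewrite gmul1r. }
  destruct (Mr (fun g => r (X g))) as [x Hx].
  { intros g. exists (X g). intros s Ss. symmetry. now apply K. }
  exists x, X. split; [exact HX|]. split.
  - intros g. exact (f_equal (fun u => u g) Hx).
  - intros g s Ss. rewrite K by assumption. exact (f_equal (fun u => u (gmul g s)) Hx).
Qed.

(** The [r]-projection of a locally admissible [y] comes from a point [x]. On each window the chosen
    local point and [x] have the same [r]-block over [S], which determines the [m]-symbol, so [y] is
    [hat m x]. *)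
Lemma good_S r m : good r -> le r m -> dt true r m -> good m.
Proof.
  intros [Mr Fr] L H. split; [|now apply (faithful_le r)].
  intros y Hy. destruct (markov_lift r m y Mr L Hy) as (x & X & HX & _ & Hr).
  exists x. apply functional_extensionality; intros g.
  rewrite <- (gmul1r G g) at 1. rewrite HX, hat_one by assumption.
  unfold hat. rewrite dt_spec in H. apply H. intros s Ss.
  specialize (Hr g s Ss). rewrite hat_mul in Hr. exact Hr.
Qed.

(* The windows [S^-1] cause no trouble: consistency of the recorded [p]-blocks compares
   the entries at [h] and [h s], both of which lie in the window [h S]. *)
Lemma good_Sinv r p m : good r -> le p r -> le r m -> le (pw false p) m ->
  le m (join r (pw false p)) -> good m.
Proof.
  intros [Mr Fr] Lp L Lpm Lm. split; [|now apply (faithful_le r)].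
  intros y Hy. destruct (markov_lift r m y Mr L Hy) as (x & X & HX & Hr & _).
  exists x. apply functional_extensionality; intros g.
  rewrite <- (gmul1r G g) at 1. rewrite HX, hat_one by assumption.
  unfold hat. apply Lm, join_eq. split; [apply Hr|].
  apply pw_eq. intros s Ss. simpl.
  set (h := gmul g (ginv s)).
  assert (Eh : gmul h s = g) by (unfold h; now rewrite <- gmulA, gmulVl, gmul1r).
  assert (E : m (X g) = hat m (X h) s).
  { rewrite <- (hat_one m), <- !HX by assumption. now rewrite gmul1r, Eh. }
  apply Lpm in E. rewrite pw_eq in E. specialize (E s Ss). simpl in E.
  rewrite <- act_mul, gmulVr, act_one in E. rewrite E.
  rewrite <- act_mul. replace (gmul s (ginv g)) with (ginv h)
    by (unfold h; now rewrite ginv_mul, ginvK).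
  apply Lp, Hr.
Qed.

Lemma good_pw l a : good a -> good (pw l a).
Proof.
  intros Ha. destruct l.
  - apply (good_S a); auto with codes.
  - apply (good_Sinv a a); auto with codes.
Qed.

Lemma good_join_pw l p v : good v -> le p v -> good (join v (pw l p)).
Proof.
  intros Hv Hp. destruct l.
  - apply (good_S v); auto with codes.
  - apply (good_Sinv v p); auto with codes.
Qed.

Definition edge (v w : code) : Prop := dt true v w /\ dt false w v.

(** The transition map between two markings, made total by the identity off the image of [hat v].
    The chosen preimage is unique once [v] is faithful. *)
Definition conv (v w : code) (y : config G) : config G :=
  match excluded_middle_informative (exists x, y = hat v x) with
  | left h => hat w (proj1_sig (constructive_indefinite_description _ h))
  | right _ => y
  end.

Lemma conv_hat v w x : faithful v -> conv v w (hat v x) = hat w x.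
Proof.
  intros F. unfold conv.
  destruct excluded_middle_informative as [h|n]; [|destruct n; now exists x].
  destruct constructive_indefinite_description as [x' E]; simpl.
  now rewrite (F _ _ E).
Qed.

Definition tr (v w : code) : Edge G :=
  {| e_src := Obj v; e_tgt := Obj w; e_fwd := conv v w; e_bwd := conv w v |}.

Lemma nbhd_continuous (T : G -> Prop) L A f :
  (forall t, T t -> In t L) -> has_nbhd T A f -> continuous_on G A f.
Proof.
  intros HL H x Ax h. exists (map (gmul h) L). intros x' Ax' E.
  rewrite has_nbhd_iff in H. apply H; auto.
  intros t Tt. apply E, in_map, HL, Tt.
Qed.

Lemma conv_nbhd_S v w : faithful v -> dt true v w -> has_nbhd S (Obj v) (conv v w).
Proof.
  intros F D. apply has_nbhd_iff. intros y y' g g' [x ->] [x' ->] E.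
  rewrite !conv_hat by assumption. unfold hat.
  rewrite dt_spec in D. apply D. intros s Ss. specialize (E s Ss).
  rewrite !hat_mul in E. exact E.
Qed.

Lemma conv_nbhd_Sinv v w : faithful w -> dt false w v ->
  has_nbhd (set_inv G S) (Obj w) (conv w v).
Proof.
  intros F D. apply has_nbhd_iff. intros y y' g g' [x ->] [x' ->] E.
  rewrite !conv_hat by assumption. unfold hat.
  rewrite dt_spec in D. apply D. intros s Ss. simpl.
  specialize (E (ginv s)). rewrite !hat_mul in E. unfold hat in E.
  rewrite ginvK in E. apply E. unfold set_inv. now rewrite ginvK.
Qed.

Lemma tr_in_H v w : good v -> good w -> edge v w -> in_H S (tr v w).
Proof.
  intros [Mv Fv] [Mw Fw] [D1 D2].
  pose proof (conv_nbhd_S v w Fv D1) as N1.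
  pose proof (conv_nbhd_Sinv v w Fw D2) as N2.
  split; [now apply markov_Obj|]. split; [now apply markov_Obj|].
  split; [|split; assumption]. simpl.
  repeat split.
  - intros y [x ->]. rewrite conv_hat by assumption. apply Obj_hat.
  - intros y [x ->]. rewrite conv_hat by assumption. apply Obj_hat.
  - intros y [x ->]. now rewrite !conv_hat.
  - intros y [x ->]. now rewrite !conv_hat.
  - apply (nbhd_continuous S SL); [intros t Ht; now apply SL_spec | exact N1].
  - apply (nbhd_continuous (set_inv G S) (map ginv SL)); [|exact N2].
    intros t Ht. rewrite <- (ginvK G t). apply in_map, SL_spec, Ht.
  - intros y [x ->] g. now rewrite <- hat_act, !conv_hat, hat_act.
Qed.

(** * Edge paths *)

Lemma valid_app p q X1 X2 X3 :
  valid S X1 p X2 -> valid S X2 q X3 -> valid S X1 (p ++ q) X3.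
Proof.
  revert X1; induction p as [|[[|] e] p IH]; simpl; intros X1.
  - now intros ->.
  - intros (H1 & H2 & H3) Hq. auto.
  - intros (H1 & H2 & H3) Hq. auto.
Qed.

Lemma homotopic_refl p X1 X2 : valid S X1 p X2 -> homotopic S X1 X2 p p.
Proof. intros H. repeat split; auto. apply rst_refl. Qed.

Lemma homotopic_sym p q X1 X2 : homotopic S X1 X2 p q -> homotopic S X1 X2 q p.
Proof. intros (H1 & H2 & H3). repeat split; auto. now apply rst_sym. Qed.

Lemma homotopic_trans q p r X1 X2 :
  homotopic S X1 X2 p q -> homotopic S X1 X2 q r -> homotopic S X1 X2 p r.
Proof.
  intros (H1 & H2 & H3) (H4 & H5 & H6). repeat split; auto. now apply rst_trans with q.
Qed.

Lemma homotopic_elem m m' p X1 X2 : elem G S m m' ->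
  valid S X1 (m ++ p) X2 -> valid S X1 (m' ++ p) X2 ->
  homotopic S X1 X2 (m ++ p) (m' ++ p).
Proof.
  intros H H1 H2. repeat split; auto. apply rst_step.
  exists [], m, m', p. auto.
Qed.

Lemma homotopic_app_r p q r X1 X2 X3 :
  homotopic S X1 X2 p q -> valid S X2 r X3 -> homotopic S X1 X3 (p ++ r) (q ++ r).
Proof.
  intros (H1 & H2 & H3) Hr.
  split; [eapply valid_app; eauto|]. split; [eapply valid_app; eauto|].
  clear H1 H2. induction H3 as [p q (a & m & m' & b & -> & -> & K & V1 & V2)| | |].
  - apply rst_step. exists a, m, m', (b ++ r).
    pose proof (valid_app _ _ _ _ _ V1 Hr). pose proof (valid_app _ _ _ _ _ V2 Hr).
    rewrite <- !app_assoc in *. auto.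
  - apply rst_refl.
  - now apply rst_sym.
  - eapply rst_trans; eauto.
Qed.

Lemma homotopic_app_l p q r X1 X2 X3 :
  homotopic S X2 X3 p q -> valid S X1 r X2 -> homotopic S X1 X3 (r ++ p) (r ++ q).
Proof.
  intros (H1 & H2 & H3) Hr.
  split; [eapply valid_app; eauto|]. split; [eapply valid_app; eauto|].
  clear H1 H2. induction H3 as [p q (a & m & m' & b & -> & -> & K & V1 & V2)| | |].
  - apply rst_step. exists (r ++ a), m, m', b.
    rewrite <- !app_assoc. repeat split; auto; eapply valid_app; eauto.
  - apply rst_refl.
  - now apply rst_sym.
  - eapply rst_trans; eauto.
Qed.

Definition inv_path (p : epath G) : epath G :=
  rev (map (fun be => (negb (fst be), snd be)) p).

Lemma inv_path_cons b e p : inv_path ((b, e) :: p) = inv_path p ++ [(negb b, e)].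
Proof. reflexivity. Qed.

Lemma valid_inv p X1 X2 : valid S X1 p X2 -> valid S X2 (inv_path p) X1.
Proof.
  revert X1; induction p as [|[b e] p IH]; intros X1.
  - simpl. now intros ->.
  - rewrite inv_path_cons. intros H.
    destruct b; destruct H as (H1 & H2 & H3); eapply valid_app;
      try (apply IH; eassumption); simpl; auto.
Qed.

Lemma homotopic_app_inv p X1 X2 : valid S X1 p X2 ->
  homotopic S X1 X1 (p ++ inv_path p) [].
Proof.
  revert X1; induction p as [|[b e] p IH]; intros X1 H.
  - now apply homotopic_refl.
  - rewrite inv_path_cons.
    change (((b, e) :: p) ++ inv_path p ++ [(negb b, e)])
      with ([(b, e)] ++ (p ++ (inv_path p ++ [(negb b, e)]))).
    rewrite (app_assoc p).
    apply (homotopic_trans ([(b, e)] ++ [] ++ [(negb b, e)])).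
    + destruct b; destruct H as (H1 & H2 & H3);
        (eapply homotopic_app_l; [eapply homotopic_app_r; [apply IH, H3|]|]); simpl; auto.
    + change ([(b, e)] ++ [] ++ [(negb b, e)]) with ([(b, e); (negb b, e)] ++ []).
      destruct b; destruct H as (H1 & H2 & H3); apply (homotopic_elem _ [] []); simpl; auto;
        constructor.
Qed.

(** The edge from [v] to [w] and the two paths to the apex [T] bound a disc in the nerve. *)
Definition coherent (T : Ob G) v pv w pw : Prop :=
  homotopic S (Obj v) T pv ((true, tr v w) :: pw).

Lemma coherent_refl T v w p : good v -> good w -> edge v w ->
  valid S (Obj w) p T -> coherent T v ((true, tr v w) :: p) w p.
Proof.
  intros Hv Hw E V. apply homotopic_refl. simpl. auto using tr_in_H.
Qed.

Lemma coherent_back T v w p : good v -> good w -> edge v w ->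
  valid S (Obj v) p T -> coherent T v p w ((false, tr v w) :: p).
Proof.
  intros Hv Hw E V. pose proof (tr_in_H v w Hv Hw E) as K.
  apply homotopic_sym.
  change ((true, tr v w) :: (false, tr v w) :: p)
    with ([(true, tr v w); (false, tr v w)] ++ p).
  apply (homotopic_elem _ [] p); [constructor | simpl; auto | exact V].
Qed.

Lemma coherent_valid_l T v pv w pw : coherent T v pv w pw -> valid S (Obj v) pv T.
Proof. now intros (H & _). Qed.

Lemma coherent_valid_r T v pv w pw : coherent T v pv w pw -> valid S (Obj w) pw T.
Proof. now intros (_ & (_ & _ & H) & _). Qed.

(** Transition maps all factor through the common set [B], hence compose exactly, and three
    compatible edges always span a 2-simplex. *)
Lemma edge_triangle T a b c p : good a -> good b -> good c ->
  edge a b -> edge b c -> edge a c -> valid S (Obj c) p T ->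
  homotopic S (Obj a) T ((true, tr a b) :: (true, tr b c) :: p) ((true, tr a c) :: p).
Proof.
  intros Ha Hb Hc Eab Ebc Eac V.
  pose proof (tr_in_H a b Ha Hb Eab). pose proof (tr_in_H b c Hb Hc Ebc).
  pose proof (tr_in_H a c Ha Hc Eac).
  apply (homotopic_elem [(true, tr a b); (true, tr b c)] [(true, tr a c)]);
    simpl; auto.
  constructor. do 3 (split; [assumption|]). repeat split.
  intros y [x ->]. simpl. destruct Ha, Hb, Hc. now rewrite !conv_hat.
Qed.

Lemma homotopic_cons (b : bool) (e : Edge G) (p q : epath G) X1 X2 : in_H S e ->
  X1 = (if b then e_src e else e_tgt e) ->
  homotopic S (if b then e_tgt e else e_src e : Ob G) X2 p q ->
  homotopic S X1 X2 ((b, e) :: p) ((b, e) :: q).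
Proof.
  intros He -> H.
  apply (homotopic_app_l p q [(b, e)] _ _ _ H). destruct b; simpl; auto.
Qed.

(** With [coherent_init] and [coherent_final] this gives two-out-of-three: in a triangle from [a]
    through [b] to [c], coherence of two sides implies that of the third. *)
Lemma coherent_comp T b pb a pa c pc : good a -> good b -> good c ->
  edge a b -> edge b c -> edge a c ->
  coherent T a pa b pb -> coherent T b pb c pc -> coherent T a pa c pc.
Proof.
  intros Ha Hb Hc Eab Ebc Eac H1 H2.
  apply (homotopic_trans _ _ _ _ _ H1).
  apply (homotopic_trans ((true, tr a b) :: (true, tr b c) :: pc)).
  - apply homotopic_cons; auto using tr_in_H.
  - apply edge_triangle; auto. eapply coherent_valid_r; eauto.
Qed.

Lemma coherent_init T c pc a pa b pb : good a -> good b -> good c ->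
  edge a b -> edge b c -> edge a c ->
  coherent T a pa c pc -> coherent T b pb c pc -> coherent T a pa b pb.
Proof.
  intros Ha Hb Hc Eab Ebc Eac H1 H2.
  apply (homotopic_trans _ _ _ _ _ H1).
  apply (homotopic_trans ((true, tr a b) :: (true, tr b c) :: pc)).
  - apply homotopic_sym, edge_triangle; auto. eapply coherent_valid_r; eauto.
  - apply homotopic_cons; auto using tr_in_H. now apply homotopic_sym.
Qed.

Lemma coherent_final T a pa b pb c pc : good a -> good b -> good c ->
  edge a b -> edge b c -> edge a c ->
  coherent T a pa b pb -> coherent T a pa c pc -> coherent T b pb c pc.
Proof.
  intros Ha Hb Hc Eab Ebc Eac H1 H2.
  pose proof (tr_in_H a b Ha Hb Eab) as Kab. pose proof (tr_in_H b c Hb Hc Ebc) as Kbc.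
  (* The triangle starts at [a] but the claim at [b], so a backtrack along the edge from [a] to [b]
     is inserted and later removed. *)
  assert (C : forall q, valid S (Obj b) q T ->
    homotopic S (Obj b) T ((false, tr a b) :: (true, tr a b) :: q) q).
  { intros q V. apply (homotopic_elem [(false, tr a b); (true, tr a b)] []);
      [constructor | simpl; auto | exact V]. }
  pose proof (coherent_valid_r _ _ _ _ _ H1). pose proof (coherent_valid_r _ _ _ _ _ H2).
  apply (homotopic_trans ((false, tr a b) :: (true, tr a b) :: pb)).
  { now apply homotopic_sym, C. }
  apply (homotopic_trans ((false, tr a b) :: (true, tr a b) :: (true, tr b c) :: pc)).
  2: { apply C. simpl; auto. }
  apply homotopic_cons; auto.
  apply (homotopic_trans pa); [now apply homotopic_sym|].
  apply (homotopic_trans _ _ _ _ _ H2).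
  apply homotopic_sym, edge_triangle; auto.
Qed.
(** * Cone paths *)

Definition pws : list bool -> code -> code := fold_left (fun a l => pw l a).

(** Refinement over [S] is an edge from coarse to fine; refinement over [S^-1] is an edge from fine
    to coarse, hence traversed backwards. *)
Definition step (l : bool) (v w : code) : bool * Edge G :=
  if l then (true, tr v w) else (false, tr w v).

(** Second phase of the cone. The invariant is that [v] refines [p] and is refined by [pws W p];
    once [W] is exhausted the two codes have the same partition and the last edge only renames
    symbols. *)
Fixpoint join_cone (W : list bool) (p v : code) : epath G :=
  match W with
  | [] => [(true, tr v p)]
  | l :: W' => step l v (join v (pw l p)) :: join_cone W' (pw l p) (join v (pw l p))
  end.

Fixpoint cone (V W : list bool) (p v : code) : epath G :=
  match V with
  | [] => join_cone W p v
  | l :: V' => step l v (pw l v) :: cone V' W p (pw l v)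
  end.

Lemma pws_mono V a b : le a b -> le (pws V a) (pws V b).
Proof. revert a b; induction V; simpl; auto with codes. Qed.

Lemma le_pws_self V a b : le b a -> le b (pws V a).
Proof.
  revert a; induction V as [|l V IH]; simpl; auto with codes.
Qed.

Lemma pw_join l a b : le (pw l (join a b)) (join (pw l a) (pw l b)).
Proof.
  intros x x' E. apply join_eq in E as [E1 E2]. rewrite pw_eq in *.
  intros s Ss. apply join_eq. auto.
Qed.

Lemma pws_join V a b : le (pws V (join a b)) (join (pws V a) (pws V b)).
Proof.
  revert a b; induction V as [|l V IH]; simpl; intros a b; [apply le_refl|].
  eapply le_trans; [apply pws_mono, pw_join | apply IH].
Qed.

Lemma step_valid l v m p T : good v -> good m -> le v m -> dt l v m ->
  valid S (Obj m) p T -> valid S (Obj v) (step l v m :: p) T.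
Proof.
  intros Hv Hm L D V.
  destruct l; simpl; split; auto; apply tr_in_H; auto; split; auto with codes.
Qed.

Lemma join_cone_valid W p v : good p -> good v -> le p v -> le v (pws W p) ->
  valid S (Obj v) (join_cone W p v) (Obj (pws W p)).
Proof.
  revert p v; induction W as [|l W IH]; simpl; intros p v Hp Hv L U.
  - split; auto. apply tr_in_H; auto. split; auto with codes.
  - pose proof (good_join_pw l p v Hv L).
    apply step_valid; auto with codes.
    apply IH; auto using good_pw with codes.
    apply join_le; auto. apply le_pws_self, le_refl.
Qed.

(** Each letter yields a square on [v], [w] and their joins [m], [m'] with the refined [p]. It is
    cut by the diagonal from [v] to [m'] for [S], and from [m] to [w] for [S^-1]; induction handles
    the side from [m] to [m']. *)
Lemma join_cone_coherent W p v w : good p -> good v -> good w -> edge v w ->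
  le p v -> le p w -> le v (pws W p) -> le w (pws W p) ->
  coherent (Obj (pws W p)) v (join_cone W p v) w (join_cone W p w).
Proof.
  revert p v w; induction W as [|l W IH]; intros p v w Hp Hv Hw [E1 E2] Lv Lw Uv Uw.
  - simpl in *.
    assert (edge v p) by (split; auto with codes).
    assert (edge w p) by (split; auto with codes).
    apply (coherent_init _ p []); auto; try (split; assumption);
      apply coherent_refl; simpl; auto.
  - pose proof (good_join_pw l p v Hv Lv) as Hm.
    pose proof (good_join_pw l p w Hw Lw) as Hm'.
    pose proof (good_pw l p Hp) as Hp'. simpl in Uv, Uw |- *.
    assert (C : coherent (Obj (pws W (pw l p)))
      (join v (pw l p)) (join_cone W (pw l p) (join v (pw l p)))
      (join w (pw l p)) (join_cone W (pw l p) (join w (pw l p)))).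
    { apply IH; auto with codes.
      - split; auto 6 with codes.
      - apply join_le; auto. apply le_pws_self, le_refl.
      - apply join_le; auto. apply le_pws_self, le_refl. }
    pose proof (coherent_valid_l _ _ _ _ _ C).
    pose proof (coherent_valid_r _ _ _ _ _ C).
    set (m := join v (pw l p)) in *. set (m' := join w (pw l p)) in *.
    assert (edge v w) by (split; assumption).
    assert (edge m m') by (split; unfold m, m'; auto 6 with codes).
    destruct l; unfold step.
    + assert (edge v m) by (split; unfold m; auto with codes).
      assert (edge w m') by (split; unfold m'; auto with codes).
      assert (edge v m') by (split; unfold m'; auto with codes).
      apply (coherent_init _ m' (join_cone W (pw true p) m')); auto.
      * eapply (coherent_comp _ m); eauto. now apply coherent_refl.
      * now apply coherent_refl.
    + assert (edge m v) by (split; unfold m; auto with codes).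
      assert (edge m' w) by (split; unfold m'; auto with codes).
      assert (edge m w) by (split; unfold m; auto with codes).
      apply (coherent_final _ m (join_cone W (pw false p) m)); auto.
      * now apply coherent_back.
      * apply (coherent_comp _ m' (join_cone W (pw false p) m')); auto.
        now apply coherent_back.
Qed.

(** The first condition lets the second phase of the cone start, the second lets it end at the
    apex. *)
Definition bounded (V W : list bool) (p v : code) : Prop :=
  le p (pws V v) /\ le (pws V v) (pws W p).

Lemma bounded_between V W p a b c : le a b -> le b c ->
  bounded V W p a -> bounded V W p c -> bounded V W p b.
Proof.
  intros L1 L2 [H1 H2] [H3 H4]. split.
  - eapply le_trans; [exact H1 | now apply pws_mono].
  - eapply le_trans; [apply pws_mono, L2 | exact H4].
Qed.

Lemma bounded_join V W p a b :
  bounded V W p a -> bounded V W p b -> bounded V W p (join a b).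
Proof.
  intros [H1 H2] [H3 H4]. split.
  - eapply le_trans; [exact H1 | apply pws_mono; auto with codes].
  - eapply le_trans; [apply pws_join | now apply join_le].
Qed.

Lemma cone_valid V W p v : good p -> good v -> bounded V W p v ->
  valid S (Obj v) (cone V W p v) (Obj (pws W p)).
Proof.
  revert v; induction V as [|l V IH]; intros v Hp Hv [H1 H2].
  - now apply join_cone_valid.
  - apply step_valid; auto using good_pw with codes.
    apply IH; auto using good_pw. split; assumption.
Qed.

Section ConeStep.
Variables (V W : list bool) (p : code).
Hypothesis good_p : good p.
Hypothesis IH : forall v w, good v -> good w -> edge v w ->
  bounded V W p v -> bounded V W p w ->
  coherent (Obj (pws W p)) v (cone V W p v) w (cone V W p w).

(** For [S], the chain of [v], [w], [pw true v], [pw true w] is increasing and two triangles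
    suffice. For [S^-1], the hypotheses give no edge between the two refined codes; both are joined
    instead to the intermediate [m], and induction applies to these two edges. *)
Lemma cone_coherent_refine l v w : good v -> good w -> le v w -> dt true v w ->
  bounded (l :: V) W p v -> bounded (l :: V) W p w ->
  coherent (Obj (pws W p)) v (cone (l :: V) W p v) w (cone (l :: V) W p w).
Proof.
  intros Hv Hw L D Bv Bw.
  pose proof (good_pw l v Hv) as Hv'. pose proof (good_pw l w Hw) as Hw'.
  assert (Vv : valid S (Obj (pw l v)) (cone V W p (pw l v)) (Obj (pws W p)))
    by now apply cone_valid.
  assert (Vw : valid S (Obj (pw l w)) (cone V W p (pw l w)) (Obj (pws W p)))
    by now apply cone_valid.
  assert (edge v w) by (split; auto with codes).
  destruct l; unfold cone; fold cone; unfold step.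
  - assert (edge v (pw true v)) by (split; auto with codes).
    assert (edge w (pw true v)) by (split; auto with codes).
    assert (edge w (pw true w)) by (split; auto with codes).
    assert (edge (pw true v) (pw true w)) by (split; auto with codes).
    apply (coherent_init _ (pw true v) (cone V W p (pw true v))); auto.
    + now apply coherent_refl.
    + apply (coherent_init _ (pw true w) (cone V W p (pw true w))); auto.
      now apply coherent_refl.
  - set (m := join w (pw false v)).
    assert (Hm : good m) by now apply good_join_pw.
    assert (Bm : bounded V W p m).
    { apply (bounded_between V W p (pw false v) m (pw false w));
        unfold m; auto with codes. }
    assert (edge (pw false v) v) by (split; auto with codes).
    assert (edge (pw false w) w) by (split; auto with codes).
    assert (edge (pw false v) w) by (split; auto with codes).
    assert (edge (pw false v) m) by (split; unfold m; auto with codes).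
    assert (edge m w) by (split; unfold m; auto with codes).
    assert (edge (pw false w) m) by (split; unfold m; auto with codes).
    apply (coherent_final _ (pw false v) (cone V W p (pw false v))); auto.
    + now apply coherent_back.
    + apply (coherent_comp _ m (cone V W p m)); auto.
      apply (coherent_final _ (pw false w) (cone V W p (pw false w))); auto.
      now apply coherent_back.
Qed.

(** Mirror image of the refining case, with edge directions and the two windows exchanged: now the
    letter [S] is the one that needs an intermediate code. *)
Lemma cone_coherent_coarsen l v w : good v -> good w -> le w v -> dt false w v ->
  bounded (l :: V) W p v -> bounded (l :: V) W p w ->
  coherent (Obj (pws W p)) v (cone (l :: V) W p v) w (cone (l :: V) W p w).
Proof.
  intros Hv Hw L D Bv Bw.
  pose proof (good_pw l v Hv) as Hv'. pose proof (good_pw l w Hw) as Hw'.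
  assert (Vv : valid S (Obj (pw l v)) (cone V W p (pw l v)) (Obj (pws W p)))
    by now apply cone_valid.
  assert (Vw : valid S (Obj (pw l w)) (cone V W p (pw l w)) (Obj (pws W p)))
    by now apply cone_valid.
  assert (edge v w) by (split; auto with codes).
  destruct l; unfold cone; fold cone; unfold step.
  - set (m := join v (pw true w)).
    assert (Hm : good m) by (apply (good_S v); unfold m; auto with codes).
    assert (Bm : bounded V W p m).
    { apply (bounded_between V W p (pw true w) m (pw true v));
        unfold m; auto with codes. }
    assert (edge v (pw true v)) by (split; auto with codes).
    assert (edge w (pw true w)) by (split; auto with codes).
    assert (edge v (pw true w)) by (split; auto with codes).
    assert (edge v m) by (split; unfold m; auto with codes).
    assert (edge m (pw true w)) by (split; unfold m; auto with codes).
    assert (edge m (pw true v)) by (split; unfold m; auto with codes).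
    apply (coherent_init _ (pw true w) (cone V W p (pw true w))); auto.
    + apply (coherent_comp _ m (cone V W p m)); auto.
      apply (coherent_init _ (pw true v) (cone V W p (pw true v))); auto.
      now apply coherent_refl.
    + now apply coherent_refl.
  - assert (edge (pw false v) v) by (split; auto with codes).
    assert (edge (pw false w) v) by (split; auto with codes).
    assert (edge (pw false w) w) by (split; auto with codes).
    assert (edge (pw false v) (pw false w)) by (split; auto with codes).
    apply (coherent_final _ (pw false w) (cone V W p (pw false w))); auto.
    + apply (coherent_final _ (pw false v) (cone V W p (pw false v))); auto.
      now apply coherent_back.
    + now apply coherent_back.
Qed.

End ConeStep.

Lemma cone_coherent V W p v w : good p -> good v -> good w -> edge v w ->
  bounded V W p v -> bounded V W p w ->
  coherent (Obj (pws W p)) v (cone V W p v) w (cone V W p w).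
Proof.
  intros Hp. revert v w; induction V as [|l V IH]; intros v w Hv Hw [D1 D2] Bv Bw.
  - destruct Bv, Bw. apply join_cone_coherent; auto. now split.
  - set (u := join v w).
    (* An edge makes [w] coarser than the block code of [v] over [S], so the join lies between [v]
       and that block code. *)
    assert (Hu : good u) by (apply (good_S v); unfold u; auto with codes).
    assert (Bu : bounded (l :: V) W p u) by now apply bounded_join.
    assert (edge v w) by now split.
    assert (edge v u) by (split; unfold u; auto with codes).
    assert (edge u w) by (split; unfold u; auto with codes).
    apply (coherent_comp _ u (cone (l :: V) W p u)); auto.
    + apply cone_coherent_refine; unfold u; auto with codes.
    + apply cone_coherent_coarsen; unfold u; auto with codes.
Qed.

(** * Contraction of edge paths onto cones *)

(** Transports the marking along [f] by reading the identity coordinate; equivariance supplies the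
    others. Taking the alphabet size from [A] gives equality of objects, which [valid] demands. *)
Lemma code_of_iso v (A : Ob G) f g : faithful v -> is_markov S A ->
  iso_pair (Obj v) A f g ->
  exists w, good w /\ Obj w = A /\ forall x, hat w x = f (hat v x).
Proof.
  intros Fv MA (H1 & H2 & H3 & H4 & _ & _ & H7).
  assert (R : forall x, 1 <= f (hat v x) gone <= ob_k A).
  { intros x. apply (markov_range _ _ _ MA), H1, Obj_hat. }
  set (w := {| csize := ob_k A; cval := fun x => f (hat v x) gone; crange := R |}).
  assert (Hw : forall x, hat w x = f (hat v x)).
  { intros x. apply functional_extensionality; intros h. unfold hat at 1. simpl.
    rewrite hat_act, H7 by apply Obj_hat. unfold shift. now rewrite ginvK, gmul1r. }
  assert (E : Obj w = A).
  { apply Ob_ext; [reflexivity|]. intros y; split.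
    - intros [x ->]. rewrite Hw. apply H1, Obj_hat.
    - intros Ay. destruct (H2 y Ay) as [x Ex]. exists x.
      now rewrite Hw, <- Ex, H4. }
  exists w. split; [|split; assumption]. split.
  - apply markov_Obj. now rewrite E.
  - intros x x' K. rewrite !Hw in K. apply Fv.
    rewrite <- (H3 _ (Obj_hat v x)), <- (H3 _ (Obj_hat v x')). now rewrite K.
Qed.

(** Converse of [tr_in_H]. The maps are compared by [same_edge], since they may differ off the
    shift. *)
Lemma edge_of_H e v w : in_H S e -> good v -> good w ->
  e_src e = Obj v -> e_tgt e = Obj w ->
  (forall x, e_fwd e (hat v x) = hat w x) ->
  edge v w /\ same_edge (tr v w) e.
Proof.
  intros (_ & _ & (_ & _ & H3 & _) & N1 & N2) [_ Fv] _ Es Et Ef.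
  rewrite Es in *. rewrite Et in *.
  assert (Eb : forall x, e_bwd e (hat w x) = hat v x)
    by (intros x; rewrite <- Ef; apply H3, Obj_hat).
  rewrite has_nbhd_iff in N1, N2. split; [split|].
  - apply dt_spec. intros x x' K. rewrite <- (hat_one w x), <- (hat_one w x'), <- !Ef.
    apply N1; try apply Obj_hat. intros s Ss. rewrite !gmul1l. now apply K.
  - apply dt_spec. intros x x' K. rewrite <- (hat_one v x), <- (hat_one v x'), <- !Eb.
    apply N2; try apply Obj_hat. intros s Ss. rewrite !gmul1l. now apply K.
  - repeat split; simpl; auto. intros y [x ->]. now rewrite conv_hat, Ef.
Qed.

(** One block of two letters absorbs one refinement over either window, so lengths can be counted
    without tracking directions. *)
Fixpoint alt (n : nat) : list bool :=
  match n with 0 => [] | Datatypes.S n => true :: false :: alt n end.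

Lemma alt_add m n : alt (m + n) = alt m ++ alt n.
Proof. induction m; simpl; congruence. Qed.

Lemma pws_app V V' a : pws (V ++ V') a = pws V' (pws V a).
Proof. apply fold_left_app. Qed.

Lemma pws_alt_le m n a b : m <= n -> le b (pws (alt m) a) -> le b (pws (alt n) a).
Proof.
  intros H L. replace n with (m + (n - m)) by lia.
  rewrite alt_add, pws_app. now apply le_pws_self.
Qed.

Lemma dt_pws_alt l a b : dt l a b -> le b (pws (alt 1) a).
Proof.
  intros D. destruct l; simpl.
  - eapply le_trans; [exact D | apply le_pw_self].
  - eapply le_trans; [exact D | apply pw_mono, le_pw_self].
Qed.

Definition near (n : nat) (a b : code) : Prop :=
  le a (pws (alt n) b) /\ le b (pws (alt n) a).

Lemma near_trans m n a b c : near m a b -> near n b c -> near (m + n) a c.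
Proof.
  intros [H1 H2] [H3 H4]. split.
  - rewrite Nat.add_comm, alt_add, pws_app. eapply le_trans; [exact H1 | now apply pws_mono].
  - rewrite alt_add, pws_app. eapply le_trans; [exact H4 | now apply pws_mono].
Qed.

Lemma near_sym n a b : near n a b -> near n b a.
Proof. intros [H1 H2]; now split. Qed.

Lemma edge_near v w : edge v w -> near 1 v w.
Proof. intros [D1 D2]. split; eapply dt_pws_alt; eauto. Qed.

(** [N] blocks lift [v] above [p]. As [v] itself lies below [N] blocks over [p], the lifted code
    lies below [N + N] blocks. *)
Lemma near_bounded n N p v : near n p v -> n <= N -> bounded (alt N) (alt (N + N)) p v.
Proof.
  intros [H1 H2] L. split.
  - now apply (pws_alt_le n).
  - rewrite alt_add, pws_app. now apply pws_mono, (pws_alt_le n).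
Qed.

(** Each edge increases the distance to [p] by at most one, so the bound on [N] lets the same words
    [V] and [W], hence the same apex, serve all vertices of [q]. Edges are then absorbed one at a
    time by [cone_coherent]. *)
Lemma path_homotopic_cones N p q v n Z : good p -> good v -> near n p v ->
  n + length q <= N -> valid S (Obj v) q Z ->
  let V := alt N in let W := alt (N + N) in
  exists w, good w /\ Obj w = Z /\ (forall x, hat w x = composite q (hat v x)) /\
    valid S (Obj w) (cone V W p w) (Obj (pws W p)) /\
    homotopic S (Obj v) (Obj (pws W p)) (cone V W p v) (q ++ cone V W p w).
Proof.
  intros Hp. revert v n; induction q as [|[b e] q IH]; intros v n Hv Hn L Vq V W.
  - assert (valid S (Obj v) (cone V W p v) (Obj (pws W p))).
    { apply cone_valid; auto. apply (near_bounded n); simpl in L; auto; lia. }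
    exists v. repeat split; auto; try apply Hv. apply rst_refl.
  - simpl in L.
    (* The code [u] marks the next vertex, by transport of the marking of [v] along [e] or its
       inverse. *)
    assert (K : exists u, good u /\ Obj u = (if b then e_tgt e else e_src e) /\
      (forall x, hat u x = (if b then e_fwd e else e_bwd e) (hat v x)) /\
      (if b then edge v u /\ same_edge (tr v u) e else edge u v /\ same_edge (tr u v) e)).
    { destruct b; destruct Vq as (He & Ev & _);
        pose proof He as (M1 & M2 & I & _).
      - rewrite Ev in I. destruct (code_of_iso v _ _ _ (proj2 Hv) M2 I) as (u & Hu & Eu & Hx).
        exists u. repeat (split; [assumption|]). apply edge_of_H; auto.
      - pose proof (iso_pair_sym _ _ _ _ _ _ M1 I) as I'. rewrite Ev in I'.
        destruct (code_of_iso v _ _ _ (proj2 Hv) M1 I') as (u & Hu & Eu & Hx).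
        exists u. repeat (split; [assumption|]). apply edge_of_H; auto.
        intros x. rewrite Hx. destruct I as (_ & _ & _ & I4 & _). apply I4.
        rewrite Ev. apply Obj_hat. }
    destruct K as (u & Hu & Eu & Hx & K).
    assert (He : in_H S e) by (destruct b; apply Vq).
    assert (Vq' : valid S (Obj u) q Z) by (rewrite Eu; destruct b; apply Vq).
    assert (Hnu : near (n + 1) p u).
    { apply (near_trans _ _ _ v); [assumption|].
      destruct b; [|apply near_sym]; apply edge_near, K. }
    assert (Bv : bounded V W p v) by (apply (near_bounded n); auto; lia).
    assert (Bu : bounded V W p u) by (apply (near_bounded (n + 1)); auto; lia).
    destruct (IH u (n + 1) Hu Hnu ltac:(lia) Vq') as (w & Hw & Ew & Hxw & Vw & Hh).
    fold V W in Vw, Hh.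
    exists w. split; [assumption|]. split; [assumption|]. split.
    { intros x. rewrite Hxw, Hx. now destruct b. }
    split; [assumption|].
    assert (Vu : valid S (Obj u) (cone V W p u) (Obj (pws W p))) by now apply cone_valid.
    apply (homotopic_trans ((b, e) :: cone V W p u)).
    + destruct b; destruct K as [Ed Es].
      * pose proof (tr_in_H v u Hv Hu Ed).
        apply (homotopic_trans ((true, tr v u) :: cone V W p u)).
        { now apply cone_coherent. }
        apply (homotopic_elem [(true, tr v u)] [(true, e)]).
        -- now constructor.
        -- simpl; auto.
        -- simpl. rewrite <- Eu. split; auto. split; auto. apply Vq.
      * pose proof (tr_in_H u v Hu Hv Ed).
        apply (homotopic_trans ((false, tr u v) :: cone V W p u)).
        { apply (homotopic_trans ((false, tr u v) :: (true, tr u v) :: cone V W p v)).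
          - apply homotopic_sym.
            apply (homotopic_elem [(false, tr u v); (true, tr u v)] []);
              [constructor | simpl | simpl]; auto 8 using cone_valid.
          - apply homotopic_cons; auto. apply homotopic_sym. now apply cone_coherent. }
        apply (homotopic_elem [(false, tr u v)] [(false, e)]).
        -- now constructor.
        -- simpl; auto.
        -- simpl. rewrite <- Eu. split; auto. split; auto. apply Vq.
    + simpl. apply homotopic_cons; auto.
      * destruct b; destruct Vq as (_ & E & _); auto.
      * destruct b; rewrite <- Eu; auto.
Qed.

(** Equal composites give the same final marking, hence the same final cone [c]. Both [q] followed
    by [c] and [q'] followed by [c] are homotopic to the cone of [p], and [c] cancels against its
    reverse. *)
Lemma homotopic_of_composite p q q' Z : good p ->
  valid S (Obj p) q Z -> valid S (Obj p) q' Z ->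
  (forall x, composite q (hat p x) = composite q' (hat p x)) ->
  homotopic S (Obj p) Z q q'.
Proof.
  intros Hp Vq Vq' E.
  assert (H0 : near 0 p p) by (split; apply le_refl).
  destruct (path_homotopic_cones (length q + length q') p q p 0 Z Hp Hp H0 ltac:(lia) Vq)
    as (w & Hw & Ew & Hx & Vw & Hh).
  destruct (path_homotopic_cones (length q + length q') p q' p 0 Z Hp Hp H0 ltac:(lia) Vq')
    as (w' & Hw' & Ew' & Hx' & _ & Hh').
  assert (w' = w) as ->.
  { apply code_ext.
    - exact (f_equal ob_k (eq_trans Ew' (eq_sym Ew))).
    - intros x. rewrite <- (hat_one w), <- (hat_one w'), Hx, Hx'. now rewrite E. }
  cbv zeta in *. revert Vw Hh Hh'.
  generalize (cone (alt (length q + length q'))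
    (alt (length q + length q' + (length q + length q'))) p w) as c.
  intros c Vc Hh Hh'. rewrite Ew in Vc.
  assert (K : forall r, valid S (Obj p) r Z -> homotopic S (Obj p) Z r ((r ++ c) ++ inv_path c)).
  { intros r Vr. rewrite <- app_assoc. rewrite <- (app_nil_r r) at 1.
    eapply homotopic_app_l; [|exact Vr].
    apply homotopic_sym. eapply homotopic_app_inv; eauto. }
  apply (homotopic_trans _ _ _ _ _ (K q Vq)).
  apply homotopic_sym, (homotopic_trans _ _ _ _ _ (K q' Vq')).
  eapply homotopic_app_r; [|apply valid_inv, Vc].
  eapply homotopic_trans; [apply homotopic_sym, Hh' | exact Hh].
Qed.

Lemma composite_app (q q' : epath G) y : composite (q ++ q') y = composite q' (composite q y).
Proof. revert y; induction q as [|[[|] e] q IH]; simpl; auto. Qed.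

Lemma composite_inv q X1 X2 : valid S X1 q X2 -> forall y, ob_set X1 y ->
  composite (inv_path q) (composite q y) = y.
Proof.
  revert X1; induction q as [|[[|] e] q IH]; intros X1 H y Hy; [reflexivity| |];
    rewrite inv_path_cons, composite_app; simpl;
    destruct H as ((_ & _ & (I1 & I2 & I3 & I4 & _) & _) & <- & H3);
    rewrite (IH _ H3); auto.
Qed.

Lemma composite_step l v w q x : good v -> good w ->
  composite (step l v w :: q) (hat v x) = composite q (hat w x).
Proof. intros [_ Fv] [_ Fw]. destruct l; simpl; now rewrite conv_hat. Qed.

Lemma composite_join_cone W p v x : good p -> good v -> le p v ->
  composite (join_cone W p v) (hat v x) = hat (pws W p) x.
Proof.
  revert p v; induction W as [|l W IH]; intros p v Hp Hv L.
  - simpl. apply conv_hat, Hv.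
  - pose proof (good_join_pw l p v Hv L). cbn [join_cone].
    rewrite composite_step by auto. apply IH; auto using good_pw with codes.
Qed.

Lemma composite_cone V W p v x : good p -> good v -> le p (pws V v) ->
  composite (cone V W p v) (hat v x) = hat (pws W p) x.
Proof.
  revert v; induction V as [|l V IH]; intros v Hp Hv L.
  - now apply composite_join_cone.
  - pose proof (good_pw l v Hv). cbn [cone].
    rewrite composite_step by auto. now apply IH.
Qed.

(** Go up the cone of [p] to the common apex and down the cone of [v]; both cones carry the markings
    to that of the apex. *)
Lemma path_of_near n p v : good p -> good v -> near n p v ->
  exists q, valid S (Obj p) q (Obj v) /\ forall x, composite q (hat p x) = hat v x.
Proof.
  intros Hp Hv Hn.
  assert (H0 : near 0 p p) by (split; apply le_refl).
  apply (near_bounded _ n) in Hn; [|lia]. apply (near_bounded _ n) in H0; [|lia].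
  set (W := alt (n + n)) in *. set (V := alt n) in *.
  pose proof (cone_valid V W p v Hp Hv Hn) as Vv.
  pose proof (cone_valid V W p p Hp Hp H0) as Vp.
  exists (cone V W p p ++ inv_path (cone V W p v)). split.
  - eapply valid_app; [exact Vp | now apply valid_inv].
  - intros x. rewrite composite_app, composite_cone by (auto; apply H0).
    rewrite <- (composite_cone V W p v) by (auto; apply Hn).
    eapply composite_inv; [exact Vv | apply Obj_hat].
Qed.

(** * Generation: finite windows inside iterated blocks *)

Hypothesis S_gen : generates G S.

Lemma pull_le_pw l s a : S s -> le (pull (mv l s) a) (pw l a).
Proof. intros Ss x x' E. simpl. rewrite pw_eq in E. auto. Qed.

(** Write [g] as a word in generators and inverses; each letter costs one block, independently of
    [a]. *)
Lemma pull_le_pws g : exists n, forall a, le (pull (ginv g) a) (pws (alt n) a).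
Proof.
  destruct (S_gen g) as (l & Hl & ->).
  induction Hl as [|s l Hs _ [n IH]].
  - exists 0. intros a x x' E. simpl in *. now rewrite ginv1, !act_one.
  - exists (n + 1). intros a. rewrite alt_add, pws_app.
    apply (le_trans (pull (ginv s) (pws (alt n) a))).
    + intros x x' E. simpl. rewrite ginv_mul, !act_mul. now apply IH.
    + destruct Hs as [Hs|Hs].
      * apply (dt_pws_alt true). exact (pull_le_pw true s _ Hs).
      * apply (dt_pws_alt false). exact (pull_le_pw false (ginv s) _ Hs).
Qed.

Lemma determined_le_pws (F : list G) (a b : code) :
  (forall x x', (forall t, In t F -> hat a x t = hat a x' t) -> b x = b x') ->
  exists n, le b (pws (alt n) a).
Proof.
  intros H.
  assert (K : exists n, forall x x', pws (alt n) a x = pws (alt n) a x' ->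
    forall t, In t F -> hat a x t = hat a x' t).
  { clear H. induction F as [|t F [n IH]].
    - exists 0. intros x x' _ t [].
    - destruct (pull_le_pws t) as [m Hm]. exists (n + m).
      intros x x' E u [<-|Hu].
      + apply (pws_alt_le m (n + m) a (pull (ginv t) a)); auto; lia.
      + apply IH; auto. revert E. apply (pws_alt_le n); [lia | apply le_refl]. }
  destruct K as [n K]. exists n. intros x x' E. auto.
Qed.

Lemma near_of_determined (F F' : list G) (a b : code) :
  (forall x x', (forall t, In t F -> hat a x t = hat a x' t) -> b x = b x') ->
  (forall x x', (forall t, In t F' -> hat b x t = hat b x' t) -> a x = a x') ->
  exists n, near n a b.
Proof.
  intros H H'. destruct (determined_le_pws F a b H) as [n Hn].
  destruct (determined_le_pws F' b a H') as [m Hm]. exists (n + m).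
  split; [apply (pws_alt_le m) | apply (pws_alt_le n)]; auto; lia.
Qed.

Lemma path_of_iso p (A : Ob G) f g (F F' : list G) : good p -> is_markov S A ->
  iso_pair (Obj p) A f g ->
  (forall y y', ob_set (Obj p) y -> ob_set (Obj p) y' ->
    (forall t, In t F -> y t = y' t) -> f y gone = f y' gone) ->
  (forall y y', ob_set A y -> ob_set A y' ->
    (forall t, In t F' -> y t = y' t) -> g y gone = g y' gone) ->
  exists q, valid S (Obj p) q A /\ forall y, ob_set (Obj p) y -> composite q y = f y.
Proof.
  intros Hp MA I Hf Hg.
  destruct (code_of_iso p A f g (proj2 Hp) MA I) as (w & Hw & <- & Hx).
  destruct I as (I1 & I2 & I3 & _).
  destruct (near_of_determined F F' p w) as [n Hn].
  - intros x x' E. rewrite <- (hat_one w), <- (hat_one w x'), !Hx.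
    apply Hf; auto using Obj_hat.
  - intros x x' E. rewrite <- (hat_one p), <- (hat_one p x').
    rewrite <- (I3 _ (Obj_hat p x)), <- (I3 _ (Obj_hat p x')), <- !Hx.
    apply Hg; auto using Obj_hat.
  - destruct (path_of_near n p w Hp Hw Hn) as (q & Vq & Cq).
    exists q. split; [exact Vq|]. intros y [x ->]. now rewrite Cq.
Qed.

End Codes.

(** * Uniform continuity *)

Section UniformContinuity.
Variable G : Group.
Arguments gmul {_}.
Arguments ginv {_}.
Arguments gone {_}.
Arguments shift {_}.
Arguments ob_k {_}.
Arguments ob_set {_}.
Arguments is_markov {_}.

Variables (S : G -> Prop) (SL : list G).
Hypothesis SL_spec : forall s, S s <-> In s SL.
Hypothesis S_gen : generates G S.

Fixpoint ball (n : nat) : list G :=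
  match n with
  | 0 => [gone]
  | Datatypes.S n => ball n ++
      flat_map (fun g => map (fun s => gmul s g) (SL ++ map ginv SL)) (ball n)
  end.

Lemma ball_mono m n g : m <= n -> In g (ball m) -> In g (ball n).
Proof.
  induction 1 as [|n _ IH]; auto. intros H. simpl. apply in_or_app; auto.
Qed.

Lemma ball_cover g : exists n, In g (ball n).
Proof.
  destruct (S_gen g) as (l & Hl & ->).
  induction Hl as [|s l Hs _ [n IH]]; [exists 0; simpl; auto|].
  exists (Datatypes.S n). simpl. apply in_or_app; right.
  apply in_flat_map. exists (fold_right gmul gone l). split; [exact IH|].
  apply (in_map (fun s => gmul s _)), in_or_app.
  destruct Hs as [Hs|Hs]; [left; now apply SL_spec|].
  right. rewrite <- (ginvK G s). apply in_map. now apply SL_spec.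
Qed.

Lemma ball_cover_list (F : list G) : exists n, forall t, In t F -> In t (ball n).
Proof.
  induction F as [|g F [n IH]]; [exists 0; intros t []|].
  destruct (ball_cover g) as [m Hm]. exists (m + n).
  intros t [<-|Ht]; [apply (ball_mono m) | apply (ball_mono n)]; auto; lia.
Qed.

Section Map.
Variables (A : Ob G) (f : config G -> config G).
Hypothesis A_markov : is_markov S A.
Hypothesis f_cont : continuous_on G A f.

Definition agree (L : list G) (x y : config G) : Prop := forall t, In t L -> x t = y t.

Definition uniform (L : list G) (x : config G) (F : list G) : Prop :=
  forall y y', ob_set A y -> ob_set A y' -> agree L y x -> agree L y' x ->
    agree F y y' -> f y gone = f y' gone.

Definition bad (L : list G) (x : config G) : Prop := ~ exists F, uniform L x F.

(** The symbol at [g] splits the cylinder into finitely many pieces. If all were uniform, the union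
    of their windows together with [g] would work for the whole cylinder. *)
Lemma bad_cons g L x : bad L x ->
  exists x', ob_set A x' /\ agree L x' x /\ bad (g :: L) x'.
Proof.
  intros Hb. apply NNPP. intros Hn. apply Hb.
  (* Pieces are merged by induction on a bound for the symbol at [g]; bound 0 is vacuous since
     symbols start at 1. *)
  assert (K : forall k, exists F, forall y y', ob_set A y -> ob_set A y' ->
    agree L y x -> agree L y' x -> y g <= k -> y g = y' g -> agree F y y' ->
    f y gone = f y' gone).
  { induction k as [|k [F IH]].
    - exists []. intros y y' Ay _ _ _ H. pose proof (markov_range _ _ _ A_markov y Ay g). lia.
    - destruct (classic (exists z, ob_set A z /\ agree L z x /\ z g = Datatypes.S k))
        as [(z & Az & Lz & Ez)|N].
      + assert (B : ~ bad (g :: L) z) by (intros B; apply Hn; exists z; auto).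
        apply NNPP in B as [F' HF']. exists (F ++ F').
        intros y y' Ay Ay' Ly Ly' Hk E Hyy.
        destruct (Nat.eq_dec (y g) (Datatypes.S k)) as [Ek|Nk].
        * apply HF'; auto.
          -- intros t [<-|Ht]; [congruence|]. rewrite Ly, Lz; auto.
          -- intros t [<-|Ht]; [congruence|]. rewrite Ly', Lz; auto.
          -- intros t Ht. apply Hyy, in_or_app; auto.
        * apply IH; auto; [lia|]. intros t Ht. apply Hyy, in_or_app; auto.
      + exists F. intros y y' Ay Ay' Ly Ly' Hk E Hyy. apply IH; auto.
        assert (y g <> Datatypes.S k) by (intros Ek; apply N; exists y; auto). lia. }
  destruct (K (ob_k A)) as [F HF]. exists (g :: F).
  intros y y' Ay Ay' Ly Ly' H. apply HF; auto.
  - apply (markov_range _ _ _ A_markov y Ay).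
  - apply H; now left.
  - intros t Ht. apply H; now right.
Qed.

Lemma bad_app L' L x : bad L x -> ob_set A x ->
  exists x', ob_set A x' /\ agree L x' x /\ bad (L' ++ L) x'.
Proof.
  intros Hb Ax. induction L' as [|g L' (y & Ay & Ly & By)].
  - exists x. repeat split; auto.
  - destruct (bad_cons g _ _ By) as (z & Az & Lz & Bz).
    exists z. repeat split; auto.
    intros t Ht. rewrite Lz by (apply in_or_app; auto). auto.
Qed.

Lemma bad_incl L L' x : (forall t, In t L <-> In t L') -> bad L x -> bad L' x.
Proof.
  intros H Hb [F HF]. apply Hb. exists F.
  intros y y' Ay Ay' Ly Ly'. apply HF; auto; intros t Ht; [apply Ly | apply Ly']; now apply H.
Qed.

Lemma bad_next n x : ob_set A x /\ bad (ball n) x ->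
  exists x', (ob_set A x' /\ bad (ball (Datatypes.S n)) x') /\ agree (ball n) x' x.
Proof.
  intros [Ax Hb].
  destruct (bad_app (ball (Datatypes.S n)) (ball n) x Hb Ax) as (x' & Ax' & Lx & Bx).
  exists x'. repeat split; auto.
  apply (bad_incl (ball (Datatypes.S n) ++ ball n)); auto.
  intros t. rewrite in_app_iff. split; [|auto].
  intros [H|H]; [exact H|]. apply (ball_mono n); auto.
Qed.

(* König's argument: a failure of uniformity persists on shrinking cylinders, whose
   intersection point would be a discontinuity. *)
Lemma uniform_continuity : exists F, forall y y', ob_set A y -> ob_set A y' ->
  (forall t, In t F -> y t = y' t) -> f y gone = f y' gone.
Proof.
  apply NNPP. intros Hn.
  (* The cylinder over the empty window is all of [A], so the zero configuration is only a
     placeholder. *)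
  assert (B0 : bad [] (fun _ => 0)).
  { intros [F HF]. apply Hn. exists F. intros y y' Ay Ay' E.
    apply HF; auto; intros t []. }
  destruct (bad_cons gone _ _ B0) as (x0 & Ax0 & _ & Bx0).
  pose (X := fix X (n : nat) : {x | ob_set A x /\ bad (ball n) x} :=
    match n with
    | 0 => exist _ x0 (conj Ax0 Bx0)
    | Datatypes.S n =>
        let c := constructive_indefinite_description _
          (bad_next n (proj1_sig (X n)) (proj2_sig (X n))) in
        exist _ (proj1_sig c) (proj1 (proj2_sig c))
    end).
  pose (x := fun n => proj1_sig (X n)).
  assert (xA : forall n, ob_set A (x n)) by (intros n; apply (proj2_sig (X n))).
  assert (xB : forall n, bad (ball n) (x n)) by (intros n; apply (proj2_sig (X n))).
  assert (xS : forall n, agree (ball n) (x (Datatypes.S n)) (x n)).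
  { intros n. unfold x. simpl.
    apply (proj2 (proj2_sig (constructive_indefinite_description _
      (bad_next n (proj1_sig (X n)) (proj2_sig (X n)))))). }
  assert (xL : forall m n, m <= n -> agree (ball m) (x n) (x m)).
  { induction 1 as [|n H IH]; intros t Ht; [reflexivity|].
    rewrite xS by (now apply (ball_mono m)). auto. }
  clearbody x. clear X.
  pose (N := fun g => proj1_sig (constructive_indefinite_description _ (ball_cover g))).
  assert (HN : forall g, In g (ball (N g)))
    by (intros g; exact (proj2_sig (constructive_indefinite_description _ (ball_cover g)))).
  (* The limit of the nested cylinders, read coordinatewise at a stage where the coordinate is
     already fixed. *)
  pose (z := fun g => x (N g) g).
  assert (Hz : forall n, agree (ball n) (x n) z).
  { intros n t Ht. unfold z. destruct (Nat.le_ge_cases n (N t)) as [H|H].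
    - symmetry. now apply (xL n).
    - now apply (xL (N t)). }
  assert (Az : ob_set A z).
  { apply (markov_local _ _ _ A_markov).
    - intros h. exact (markov_range _ _ _ A_markov _ (xA (N h)) h).
    - intros g. destruct (ball_cover_list (map (gmul g) SL)) as [n Hn'].
      exists (shift (ginv g) (x n)). split.
      + apply (markov_shift _ _ _ A_markov), xA.
      + intros s Ss. unfold shift. rewrite ginvK. symmetry. apply Hz, Hn', in_map.
        now apply SL_spec. }
  (* Once a ball contains the continuity window of [z], the map is constant at the identity on that
     cylinder, so the empty window witnesses uniformity there. *)
  destruct (f_cont z Az gone) as [F HF].
  destruct (ball_cover_list F) as [n Hn']. apply (xB n). exists [].
  intros y y' Ay Ay' Ly Ly' _.
  rewrite (HF y), (HF y'); auto; intros t Ht.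
  - rewrite Ly' by auto. apply Hz; auto.
  - rewrite Ly by auto. apply Hz; auto.
Qed.

End Map.
End UniformContinuity.

(** * The base code and the conclusion *)

(** Takes the points of [Y] with the shift as [B] and the symbol at the identity as the code, so
    that [hat] is the inclusion. *)
Lemma exists_base_code (G : Group) (S : G -> Prop) (Y : Ob G) :
  S (gone G) -> is_markov G S Y ->
  exists (B : Type) (act : G -> B -> B),
    (forall g h x, act (gmul G g h) x = act g (act h x)) /\
    (forall x, act (gone G) x = x) /\
    exists p : code B, good G S B act p /\ Obj G B act p = Y.
Proof.
  intros S1 MY.
  pose (B := {x | ob_set G Y x}).
  pose (act := fun (g : G) (x : B) =>
    exist (ob_set G Y) (shift G g (proj1_sig x)) (markov_shift G S Y MY g _ (proj2_sig x)) : B).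
  assert (Bext : forall x y : B, proj1_sig x = proj1_sig y -> x = y)
    by (intros [x Hx] [y Hy]; apply subset_eq_compat).
  assert (act_mul : forall g h x, act (gmul G g h) x = act g (act h x))
    by (intros g h x; apply Bext, shift_mul).
  assert (act_one : forall x, act (gone G) x = x)
    by (intros x; apply Bext, shift_one).
  exists B, act. repeat (split; [assumption|]).
  pose (p := {| csize := ob_k G Y; cval := fun x : B => proj1_sig x (gone G);
    crange := fun x => markov_range G S Y MY _ (proj2_sig x) (gone G) |}).
  assert (Hp : forall x, hat G B act p x = proj1_sig x).
  { intros x. apply functional_extensionality; intros g. unfold hat, p, shift; simpl.
    unfold shift. now rewrite ginvK, gmul1r. }
  assert (E : Obj G B act p = Y).
  { apply Ob_ext; [reflexivity|]. intros y; split.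
    - intros [x ->]. rewrite Hp. exact (proj2_sig x).
    - intros Hy. exists (exist _ y Hy). now rewrite Hp. }
  exists p. split; [split|exact E].
  - apply markov_Obj; auto. now rewrite E.
  - intros x x' K. rewrite !Hp in K. now apply Bext.
Qed.

Lemma id_edge_in_H (G : Group) (S : G -> Prop) (Y : Ob G) :
  S (gone G) -> is_markov G S Y -> in_H G S (id_edge G Y).
Proof.
  intros S1 MY. split; [exact MY|]. split; [exact MY|]. split; [|split].
  - repeat split; simpl; auto; intros x _ h; exists [h]; intros x' _ E;
      apply E; simpl; auto.
  - apply has_nbhd_iff. intros x x' g g' _ _ E.
    rewrite <- (gmul1r G g), <- (gmul1r G g'). now apply E.
  - apply has_nbhd_iff. intros x x' g g' _ _ E.
    rewrite <- (gmul1r G g), <- (gmul1r G g'). apply E. unfold set_inv. now rewrite ginv1.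
Qed.

Theorem mainTheorem4 (G : Group) (S : G -> Prop) (X : Ob G) :
  finite_subset G S -> generates G S -> S (gone G) ->
  is_markov G S X ->
  homotopically_uniquely_generates G S X.
Proof.
  intros [SL HSL] Hgen S1 _. split; [|split].
  - intros Y [MY _]. now apply id_edge_in_H.
  - intros Y Z f [MY _] [MZ _] [g I].
    (* Uniform windows for the map and its inverse bound the distance between the codes of source
       and target. *)
    destruct (uniform_continuity G S SL HSL Hgen Y f MY) as [F HF]; [apply I|].
    destruct (uniform_continuity G S SL HSL Hgen Z g MZ) as [F' HF']; [apply I|].
    destruct (exists_base_code G S Y S1 MY) as (B & act & act_mul & act_one & p & Hp & <-).
    eapply path_of_iso; eauto.
  - intros Y Z q q' [MY _] _ Vq Vq' E.
    destruct (exists_base_code G S Y S1 MY) as (B & act & act_mul & act_one & p & Hp & <-).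
    eapply homotopic_of_composite; eauto. intros x. apply E. now exists x.
Qed.
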